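(* Assume that $\delta=1/2$. Then, for any $\eta>0$, $$|S_n|=o\big(\sqrt{n(\log n)(\log\log n)^{1+\eta}}\big)\quad\text{a.s. as } n\to\infty.$$
   Context: Setting. Let $d\ge 1$ and let $\mathcal{S}_{\mathfrak{e}},\mathcal{S}_{\mathfrak{o}},V_{\mathfrak{e}},V_{\mathfrak{o}}\subset\mathbf{R}^d$, with $V_{\mathfrak{o}},V_{\mathfrak{e}}$ finite, satisfy: (1) $x+v\in\mathcal{S}_{\mathfrak{o}}$ for $x\in\mathcal{S}_{\mathfrak{e}}$, $v\in V_{\mathfrak{o}}$; (2) $x+v\in\mathcal{S}_{\mathfrak{e}}$ for $x\in\mathcal{S}_{\mathfrak{o}}$, $v\in V_{\mathfrak{e}}$; (3) $V_{\mathfrak{o}}=-V_{\mathfrak{e}}$; (4) $0\in\mathcal{S}_{\mathfrak{e}}$; (5) $V_{\mathfrak{o}}\cap V_{\mathfrak{e}}=\emptyset$. Put $V=V_{\mathfrak{o}}\cup V_{\mathfrak{e}}$, let $m$ be the common cardinality of $V_{\mathfrak{o}}$ and $V_{\mathfrak{e}}$, and assume $m\ge2$. Fix $p,q\in[0,1]$ and set $\alpha=\frac{mp-1}{m-1}$, $\beta=\frac{mq-1}{m-1}$, $\delta=\frac12(\alpha-\beta)$. For each $k\ge2$ and $v\in V$ let $G_k(v)$ be a random variable with values in $V_{\mathfrak{o}}$ if $k$ is odd and in $V_{\mathfrak{e}}$ if $k$ is even, with the following law. Let $W$ denote $V_{\mathfrak{o}}$ if $k$ is odd and $V_{\mathfrak{e}}$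 if $k$ is even, and let $w\in W$. If $v\in W$, then $\boldsymbol{P}(G_k(v)=w)=p$ for $w=v$ and $\frac{1-p}{m-1}$ for $w\ne v$. If $v\in V\setminus W$ (so $-v\in W$), then $\boldsymbol{P}(G_k(v)=w)=q$ for $w=-v$ and $\frac{1-q}{m-1}$ for $w\neq -v$. Let $X_1$ be uniform on $V_{\mathfrak{o}}$ and, for $n\ge1$, let $\mathcal{U}_n$ be uniform on $\{1,\dots,n\}$. The $\sigma$-fields $\sigma(X_1),\ \sigma(\mathcal{U}_1,\{G_2(v)\}_{v\in V}),\ \sigma(\mathcal{U}_2,\{G_3(v)\}_{v\in V}),\dots$ are independent, and for each $n\ge1$, $\mathcal{U}_n$ is independent of $\{G_{n+1}(v)\}_{v\in V}$. Define, for $n\geq 1$, $X_{n+1}=G_{n+1}(X_{\mathcal{U}_n})$; and $S_0=0$, $S_{n+1}=S_n+X_{n+1}$ for $n\ge0$ (the elephant random walk). $a_n=o(b_n)$ means $a_n/b_n\to0$; $|\cdot|$ is the Euclidean norm. *)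

(* Defs.v *)
From HB Require Import structures.
From mathcomp Require Export all_boot all_order all_algebra finmap.
From mathcomp Require Export all_classical all_reals all_analysis.
Export Order.TTheory GRing.Theory Num.Theory.
Export numFieldNormedType.Exports.

Set Implicit Arguments.
Unset Strict Implicit.
Unset Printing Implicit Defensive.

#[global] Open Scope classical_set_scope.
#[global] Open Scope ring_scope.

(* The canonical norm of 'rV[R]_d in the library is the sup norm. *)
Definition enorm (R : realType) (d : nat) (x : 'rV[R]_d) : R :=
  Num.sqrt (\sum_(i < d) x ord0 i ^+ 2).

Section Independence.
Context {disp : measure_display} {T : measurableType disp} {R : realType}.

(* The sigma-field generated by Y when its codomain E carries the discrete
   sigma-field.  For a vector-valued Y with finite range this is the same as
   the preimage of the Borel sigma-field. *)
Definition sigma_of {E : Type} (Y : T -> E) : set (set T) :=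
  preimage_set_system [set: T] Y [set: set E].

Definition finite_rv {E : choiceType} (A : {fset E}) (Y : T -> E) : Prop :=
  (forall t, Y t \in A) /\ sigma_of Y `<=` measurable.

Definition independent2 (P : probability T R) (F G : set (set T)) : Prop :=
  forall A B, F A -> G B -> P (A `&` B) = (P A * P B)%E.

Definition mutually_independent {I : choiceType} (P : probability T R)
    (F : I -> set (set T)) : Prop :=
  forall (J : {fset I}) (A : I -> set T),
    (forall i, i \in J -> F i (A i)) ->
    P (\bigcap_(i in [set` J]) A i) = (\prod_(i <- J) P (A i))%E.

End Independence.

Record erw_lattice (R : realType) (d : nat) (Se So : set 'rV[R]_d)
    (Ve Vo : {fset 'rV[R]_d}) : Prop := ErwLattice {
  lattice_even : forall x v, Se x -> v \in Vo -> So (x + v) ;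
  lattice_odd : forall x v, So x -> v \in Ve -> Se (x + v) ;
  lattice_opp : Vo = [fset - v | v in Ve]%fset ;
  lattice_origin : Se 0 ;
  lattice_disjoint : (Vo `&` Ve)%fset = fset0 }.

Section Walk.
Context {disp : measure_display} {T : measurableType disp} {R : realType}.
Context {d : nat}.
Implicit Types (Ve Vo : {fset 'rV[R]_d}) (k n : nat).

Definition step_set Ve Vo k : {fset 'rV[R]_d} := if odd k then Vo else Ve.

(* P(G_k(v) = w), meaningful for v in Vo `|` Ve and w in step_set Ve Vo k. *)
Definition step_law Ve Vo (p q : R) k (v w : 'rV[R]_d) : R :=
  let m : R := (#|` Vo|%fset)%:R in
  if v \in step_set Ve Vo k
  then if w == v then p else (1 - p) / (m - 1)
  else if w == - v then q else (1 - q) / (m - 1).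

(* The sigma-field of the innovations (U_n, {G_(n+1)(v)}_v) for n >= 1;
   index 0 is the sigma-field of X_1. *)
Definition innovation Ve Vo (U : nat -> T -> nat)
    (G : nat -> 'rV[R]_d -> T -> 'rV[R]_d) (X : nat -> T -> 'rV[R]_d) n :
    set (set T) :=
  if n is 0 then sigma_of (X 1)
  else <<s sigma_of (U n) `|`
        \bigcup_(v in [set` (Vo `|` Ve)%fset]) sigma_of (G n.+1 v) >>.

(* U and X are only constrained at indices n >= 1, and G k v at k >= 2 and
   v in Vo `|` Ve. *)
Record elephant_walk (P : probability T R) Ve Vo (p q : R)
    (U : nat -> T -> nat) (G : nat -> 'rV[R]_d -> T -> 'rV[R]_d)
    (X : nat -> T -> 'rV[R]_d) : Prop := ElephantWalk {
  erw_G_rv : forall k v, (2 <= k)%N -> v \in (Vo `|` Ve)%fset ->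
    finite_rv (step_set Ve Vo k) (G k v) ;
  erw_G_law : forall k v w, (2 <= k)%N -> v \in (Vo `|` Ve)%fset ->
    w \in step_set Ve Vo k ->
    P [set t | G k v t = w] = (step_law Ve Vo p q k v w)%:E ;
  erw_X1_rv : finite_rv Vo (X 1) ;
  erw_X1_law : forall v, v \in Vo ->
    P [set t | X 1 t = v] = ((#|` Vo|%fset)%:R^-1)%:E ;
  erw_U_rv : forall n, (1 <= n)%N ->
    finite_rv [fset k in iota 1 n]%fset (U n) ;
  erw_U_law : forall n k, (1 <= k <= n)%N ->
    P [set t | U n t = k] = (n%:R^-1)%:E ;
  erw_indep : mutually_independent P (innovation Ve Vo U G X) ;
  erw_UG_indep : forall n, (1 <= n)%N ->
    independent2 P (sigma_of (U n))
      <<s \bigcup_(v in [set` (Vo `|` Ve)%fset]) sigma_of (G n.+1 v) >> ;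
  erw_rec : forall n t, (1 <= n)%N -> X n.+1 t = G n.+1 (X (U n t) t) t }.

Fixpoint position (X : nat -> T -> 'rV[R]_d) n (t : T) : 'rV[R]_d :=
  if n is n'.+1 then position X n' t + X n t else 0.

End Walk.

Definition erw_alpha {R : realType} (m : nat) (p : R) : R :=
  (m%:R * p - 1) / (m%:R - 1).

Definition erw_beta {R : realType} (m : nat) (q : R) : R :=
  (m%:R * q - 1) / (m%:R - 1).

Definition erw_delta {R : realType} (m : nat) (p q : R) : R :=
  2^-1 * (erw_alpha m p - erw_beta m q).

(* a_n = o(b_n) for real sequences, as a_n / b_n --> 0. *)
Definition seq_littleo {R : realType} (a b : nat -> R) : Prop :=
  (fun n => a n / b n) @ \oo --> (0 : R).

(* Main.v *)
Require Import Defs.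
From mathcomp Require Import ring lra.

Set Implicit Arguments.
Unset Strict Implicit.
Unset Printing Implicit Defensive.

(** Why the theorem holds.  Fix a coordinate and center the steps: let u_k be the
    coordinate of X_(k+1) minus its mean (-1)^k c.  The kernel of the walk maps a
    centered step to alpha or - beta times itself, according to whether the
    remembered step has the parity of the new one ([step_law_mean]).  With
    gamma = (alpha + beta) / 2 and alpha - beta = 2 delta = 1, the conditional
    mean of u_n given the first n steps is therefore
      (s_n / 2 + (-1)^n gamma d_n) / n,
    where s_n = sum_(k < n) u_k and d_n = sum_(k < n) (-1)^k u_k, and the
    difference xi_n between u_n and this mean is a bounded martingale difference
    ([elephant_mean], [noise_orthogonal]).

    The term with d_n alternates in sign.  Replacing s_n by
    s_n + (-1)^n (gamma / 2) d_n / n, which changes it by a bounded amount,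
    cancels that term up to O(1 / n), and the trivial bound |d_n| = O(n) is enough
    to control what remains.  Since sqrt n solves the recursion
    y_(n+1) = (1 + 1 / (2 n)) y_n up to a summable error, it follows
    deterministically that
      |s_n| / sqrt n <= K + |N_n|,   N_n = sum_(1 <= k < n) xi_k / sqrt (k + 1)
    ([drift_removal]).

    The martingale N_n has variance O(ln n).  Kolmogorov's maximal inequality
    ([kolmogorov_inequality]) on the blocks 2^(2^j) <= n < 2^(2^(j+1)), along
    which ln n doubles, and the Borel-Cantelli lemma give almost surely
    N_n^2 <= 2^j (j + 2)^(1 + eta / 2) in all but finitely many blocks
    ([dyadic_control]), that is N_n^2 = O(ln n (ln ln n)^(1 + eta / 2)).  The
    remaining factor (ln ln n)^(eta / 2) of the normalization tends to
    infinity. *)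

(** * Random variables with finitely many values *)

Section known.
Context {T : Type}.
Implicit Types F : set (set T).

(** As every preimage is asked to lie in F, the codomain E needs no sigma-field of
    its own, and the notion is stable under arbitrary functions of finitely many
    such variables. *)
Definition finitely_known F {E : Type} (f : T -> E) : Prop :=
  finite_set (range f) /\ forall C, F (f @^-1` C).

Lemma sigma_algebra_setI F : sigma_algebra setT F -> setI_closed F.
Proof. by move=> sF; have /sigma_algebraP[] := sF. Qed.

Lemma sigma_algebra_fin_bigcup F : sigma_algebra setT F -> fin_bigcup_closed F.
Proof.
move=> [F0 _ FU]; apply/fin_bigcup_closedP; split => // A B FA FB.
by rewrite -bigcup2E; apply: (FU (bigcup2 A B)) => -[|[|n]].
Qed.

Lemma finitely_known_comp F (E E' : Type) (h : E -> E') (f : T -> E) :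
  finitely_known F f -> finitely_known F (h \o f).
Proof.
move=> [ff Ff]; split; last by move=> C; exact: (Ff (h @^-1` C)).
by rewrite -(image_comp f h); exact: finite_image.
Qed.

Lemma finitely_known_cst F (E : Type) (e : E) :
  sigma_algebra setT F -> finitely_known F (fun=> e).
Proof.
move=> [F0 FC _]; split.
  by apply: (@sub_finite_set _ _ [set e]) => // _ [t _ <-].
move=> C; rewrite preimage_cst; case: ifPn => // _.
by rewrite -[setT](setD0); exact: FC.
Qed.

Lemma finitely_knownS F F' (E : Type) (f : T -> E) :
  F `<=` F' -> finitely_known F f -> finitely_known F' f.
Proof. by move=> FF' [ff Ff]; split => // C; exact/FF'/Ff. Qed.

Lemma finitely_known_pair F (E E' : Type) (f : T -> E) (g : T -> E') :
  sigma_algebra setT F -> finitely_known F f -> finitely_known F g ->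
  finitely_known F (fun t => (f t, g t)).
Proof.
move=> sF [ff Ff] [fg Fg].
have fin : finite_set (range (fun t => (f t, g t))).
  apply: (@sub_finite_set _ _ (range f `*` range g)).
    by move=> _ [t _ <-]; split; exists t.
  exact: finite_setX.
split => // C.
rewrite (_ : _ @^-1` C = \bigcup_(e in range (fun t => (f t, g t)) `&` C)
   (f @^-1` [set e.1] `&` g @^-1` [set e.2])); last first.
  apply/seteqP; split => [t Ct|t [[a b] [_ Cab] [/= fa gb]]].
    by exists (f t, g t) => //; split => //; exists t.
  by rewrite /preimage/= fa gb.
apply: sigma_algebra_fin_bigcup => //; first exact: finite_setIl.
by move=> e _; apply: sigma_algebra_setI.
Qed.

Lemma finitely_known_comp2 F (E E' : Type) (E'' : Type) (h : E -> E' -> E'')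
    (f : T -> E) (g : T -> E') :
  sigma_algebra setT F -> finitely_known F f -> finitely_known F g ->
  finitely_known F (fun t => h (f t) (g t)).
Proof.
move=> sF kf kg.
exact: (finitely_known_comp (fun e => h e.1 e.2) (finitely_known_pair sF kf kg)).
Qed.

(** Joint knowledge of a whole family: any function of the family, such as the
    step copied from the remembered past, is then known by composition. *)
Lemma finitely_known_map F (I : eqType) (E : Type) (f : I -> T -> E) (s : seq I) :
  sigma_algebra setT F -> (forall i, i \in s -> finitely_known F (f i)) ->
  finitely_known F (fun t => [seq f i t | i <- s]).
Proof.
move=> sF; elim: s => [|i s IH] ks /=; first exact: finitely_known_cst.
apply: finitely_known_comp2 => //; first by apply: ks; rewrite inE eqxx.
by apply: IH => j js; apply: ks; rewrite inE js orbT.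
Qed.
End known.

Section mean.
Context {disp : measure_display} {T : measurableType disp} {R : realType}
  (P : probability T R).

Lemma finitely_known_measurable (f : T -> R) :
  finitely_known measurable f -> measurable_fun setT f.
Proof. by move=> [_ Ff] _ B _; rewrite setTI; exact: Ff. Qed.

Lemma finitely_known_integrable (f : T -> R) :
  finitely_known measurable f -> P.-integrable setT (EFin \o f).
Proof.
move=> kf; apply: measurable_bounded_integrable => //.
- exact: le_lt_trans (probability_le1 P measurableT) (ltry 1).
- exact: finitely_known_measurable.
- have /compact_bounded[M [Mr bM]] := finite_compact kf.1.
  by exists M; split => // x Mx t _ /=; apply: (bM x Mx); exists t.
Qed.

Lemma meanD (f g : T -> R) : finitely_known measurable f -> finitely_known measurable g ->
  \int[P]_t (f t + g t) = \int[P]_t f t + \int[P]_t g t.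
Proof. by move=> kf kg; apply: RintegralD => //; exact: finitely_known_integrable. Qed.

Lemma meanZ (c : R) (f : T -> R) : finitely_known measurable f ->
  \int[P]_t (c * f t) = c * \int[P]_t f t.
Proof. by move=> kf; apply: RintegralZl => //; exact: finitely_known_integrable. Qed.

Lemma measurable_sigma_algebra : sigma_algebra setT (@measurable _ T).
Proof.
split => //; first by move=> A mA; exact: measurableD.
by move=> A mA; exact: bigcupT_measurable.
Qed.

Lemma finitely_known_sum F (I : eqType) (s : seq I) (f : I -> T -> R) :
  sigma_algebra setT F -> (forall i, i \in s -> finitely_known F (f i)) ->
  finitely_known F (fun t => \sum_(i <- s) f i t).
Proof.
move=> sF ks; have := finitely_known_comp (fun r : seq R => \sum_(x <- r) x)
  (finitely_known_map sF ks).
by congr finitely_known; apply/funext => t /=; rewrite big_map.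
Qed.

Lemma mean_sum (I : eqType) (s : seq I) (f : I -> T -> R) :
  (forall i, i \in s -> finitely_known measurable (f i)) ->
  \int[P]_t (\sum_(i <- s) f i t) = \sum_(i <- s) \int[P]_t f i t.
Proof.
elim: s => [|i s IH] ks.
  by under eq_Rintegral do rewrite big_nil; rewrite Rintegral_cst// mul0r big_nil.
have ks' j : j \in s -> finitely_known measurable (f j).
  by move=> js; apply: ks; rewrite inE js orbT.
rewrite big_cons -IH// -meanD; [|by apply: ks; rewrite inE eqxx|].
  by apply: eq_Rintegral => t _; rewrite big_cons.
by apply: finitely_known_sum => //; exact: measurable_sigma_algebra.
Qed.

Lemma le_mean (f g : T -> R) :
  finitely_known measurable f -> finitely_known measurable g ->
  (forall t, f t <= g t) -> \int[P]_t f t <= \int[P]_t g t.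
Proof.
by move=> kf kg fg; apply: le_Rintegral => //; exact: finitely_known_integrable.
Qed.

Lemma mean_cst (c : R) : \int[P]_t c = c.
Proof.
rewrite Rintegral_cst// -[RHS]mulr1; congr (_ * _).
exact: (congr1 fine (probability_setT P)).
Qed.

Lemma mean_indic (A : set T) : measurable A -> \int[P]_t \1_A t = fine (P A).
Proof. by move=> mA; rewrite /Rintegral integral_indic// setIT. Qed.

Lemma finitely_known_indic F (A : set T) : sigma_algebra setT F -> F A ->
  finitely_known F (\1_A : T -> R).
Proof.
move=> sF FA; split.
  by apply: (@sub_finite_set _ _ [set 0; 1]) => // _ [t _ <-];
     rewrite indicE; case: (_ \in _); [right|left].
move=> C; rewrite preimage_indic; case: sF => F0 FC _.
have FT : F setT by rewrite -(setD0 setT); exact: FC.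
by do 2 case: ifP => // _; rewrite -setTD; exact: FC.
Qed.

Lemma chebyshev_mean (f : T -> R) (l : R) : finitely_known measurable f -> 0 < l ->
  fine (P [set t | l <= `|f t|]) <= \int[P]_t f t ^+ 2 / l ^+ 2.
Proof.
move=> kf l0.
have mA : measurable [set t | l <= `|f t|] by exact: (kf.2 [set x | l <= `|x|]).
rewrite ler_pdivlMr ?exprn_gt0// mulrC -mean_indic// -meanZ; last first.
  exact: finitely_known_indic measurable_sigma_algebra _.
apply: le_mean.
- apply: (finitely_known_comp (fun x => l ^+ 2 * x)).
  exact: finitely_known_indic measurable_sigma_algebra _.
- exact: (finitely_known_comp (fun x => x ^+ 2)).
- move=> t; rewrite indicE; case: (boolP (t \in _)) => [|_]; last by rewrite mulr0 sqr_ge0.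
  rewrite inE/= => lf; rewrite mulr1 -(real_normK (num_real (f t))).
  by rewrite lerXn2r ?nnegrE ?normr_ge0 ?(ltW l0).
Qed.

End mean.

(** * The maximal inequality *)

Section kolmogorov.
Context {disp : measure_display} {T : measurableType disp} {R : realType}
  (P : probability T R).
Variables (F : nat -> set (set T)) (D : nat -> T -> R) (c : nat -> R).
Hypothesis sF : forall n, sigma_algebra setT (F n).
Hypothesis FS : forall n, F n `<=` F n.+1.
Hypothesis Fm : forall n, F n `<=` measurable.
Hypothesis kD : forall n, finitely_known (F n.+1) (D n).
Hypothesis Dc : forall n t, D n t ^+ 2 <= c n.
Hypothesis D0 : forall n (Y : T -> R), finitely_known (F n) Y ->
  \int[P]_t (Y t * D n t) = 0.

(** The partial sums of D, frozen from the first time that their absolute value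
    reaches l.  As a recursion on the current value alone it needs no stopping
    time, since a frozen value stays outside the interval. *)
Fixpoint stopped (l : R) n (t : T) : R :=
  if n is n'.+1 then
    stopped l n' t + (if `|stopped l n' t| < l then D n' t else 0)
  else 0.

Lemma finitely_known_stopped l n : finitely_known (F n) (stopped l n).
Proof.
elim: n => [|n IH] /=; first exact: finitely_known_cst.
exact: (finitely_known_comp2 (fun v x => v + (if `|v| < l then x else 0))
  (sF n.+1) (finitely_knownS (@FS n) IH) (kD n)).
Qed.

Lemma stoppedP (l : R) n t : 0 < l ->
  (stopped l n t = \sum_(i < n) D i t /\
     forall k, (k <= n)%N -> `|\sum_(i < k) D i t| < l) \/
  (l <= `|stopped l n t| /\
     exists2 k, (k <= n)%N & l <= `|\sum_(i < k) D i t|).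
Proof.
move=> l0; elim: n => [|n [[VN small]|[large [k kn Nk]]]] /=.
- left; split; first by rewrite big_ord0.
  by move=> k; rewrite leqn0 => /eqP ->; rewrite big_ord0 normr0.
- rewrite VN small//.
  have -> : \sum_(i < n) D i t + D n t = \sum_(i < n.+1) D i t by rewrite big_ord_recr.
  have [ltl|lel] := ltP `|\sum_(i < n.+1) D i t| l.
    left; split => // k; rewrite leq_eqVlt ltnS => /predU1P[->//|]; exact: small.
  by right; split => //; exists n.+1.
- right; rewrite ltNge large/= addr0; split => //; exists k => //; exact: leqW.
Qed.

(** The increment of the square is 2 V D + D^2, where V is either the current
    value or 0 and is known before D is drawn, so the cross term has mean 0. *)
Lemma mean_stopped_sq (l : R) n :
  \int[P]_t (stopped l n t ^+ 2) <= \sum_(i < n) c i.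
Proof.
have kV k : finitely_known measurable (stopped l k).
  exact: finitely_knownS (@Fm k) (finitely_known_stopped l k).
have kDm k : finitely_known measurable (D k) := finitely_knownS (@Fm _) (kD k).
have sm := @measurable_sigma_algebra _ T.
elim: n => [|n IH] /=.
  rewrite big_ord0; under eq_Rintegral do rewrite expr0n/=.
  by rewrite mean_cst.
rewrite big_ord_recr/=.
pose Y t := (if `|stopped l n t| < l then 2 * stopped l n t else 0).
have kY : finitely_known (F n) Y.
  exact: (finitely_known_comp (fun v => if `|v| < l then 2 * v else 0)
    (finitely_known_stopped l n)).
have kYD : finitely_known measurable (fun t => Y t * D n t).
  by apply: finitely_known_comp2 => //; exact: finitely_knownS (@Fm n) kY.
have kV2 k : finitely_known measurable (fun t => stopped l k t ^+ 2).
  exact: (finitely_known_comp (fun v => v ^+ 2)).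
have kS : finitely_known measurable (fun t => stopped l n t ^+ 2 + Y t * D n t).
  exact: finitely_known_comp2.
have kcst : finitely_known measurable (fun _ : T => c n).
  exact: finitely_known_cst.
apply: (@le_trans _ _ (\int[P]_t ((stopped l n t ^+ 2 + Y t * D n t) + c n))).
  apply: le_mean; first exact: (kV2 n.+1).
    exact: finitely_known_comp2.
  move=> t; rewrite /Y; have := Dc n t.
  case: ifP => _ Dt; last by rewrite addr0 mul0r addr0 lerDl (le_trans _ Dt)// sqr_ge0.
  by rewrite sqrrD -mulr_natl mulrA lerD2l.
by rewrite meanD// meanD// D0// addr0 mean_cst lerD2r.
Qed.

(** Some partial sum up to n reaches the level l exactly when the stopped sum
    is beyond l at time n, and Chebyshev's inequality applies to the latter. *)
Lemma kolmogorov_inequality (l : R) n : 0 < l ->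
  (P (\bigcup_(k in [set k | (k <= n)%N]) [set t | (l <= `|\sum_(i < k) D i t|)%R])
   <= ((\sum_(i < n) c i) / l ^+ 2)%:E)%E.
Proof.
move=> l0; rewrite (_ : \bigcup_(_ in _) _ = [set t | l <= `|stopped l n t|]).
  have kV := finitely_knownS (@Fm n) (finitely_known_stopped l n).
  rewrite -[leLHS]fineK ?fin_num_measure//; last first.
    exact: (kV.2 [set x | l <= `|x|]).
  rewrite lee_fin; apply: le_trans (chebyshev_mean P kV l0) _.
  by rewrite ler_wpM2r ?mean_stopped_sq// invr_ge0 sqr_ge0.
apply/seteqP; split => t /=.
  move=> [k kn Nk]; have [[_ /(_ k kn)]|[]//] := stoppedP n t l0.
  by rewrite ltNge Nk.
have [[-> small]|[_ [k kn Nk]]] := stoppedP n t l0; last by exists k.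
by exists n => /=.
Qed.

End kolmogorov.

(** * Independence of the past *)

Section independence_of_the_past.
Context {disp : measure_display} {T : measurableType disp} {R : realType}
  (P : probability T R).
Variable I : nat -> set (set T).
Hypothesis sI : forall n, sigma_algebra setT (I n).
Hypothesis Im : forall n, I n `<=` measurable.
Hypothesis indepI : mutually_independent P I.

Definition past n : set (set T) := <<s \bigcup_(i in [set i | (i < n)%N]) I i >>.

Lemma past_sigma_algebra n : sigma_algebra setT (past n).
Proof. exact: smallest_sigma_algebra. Qed.

Lemma past_measurable n : past n `<=` measurable.
Proof.
apply: smallest_sub; first exact: measurable_sigma_algebra.
by move=> A [i _ IA]; exact: Im IA.
Qed.

Lemma pastS n : past n `<=` past n.+1.
Proof. by apply: sub_sigma_algebra2 => A [i /= ni IA]; exists i => //=; exact: ltnW. Qed.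

Lemma innovation_past n : I n `<=` past n.+1.
Proof. by move=> A IA; apply: sub_sigma_algebra; exists n => /=. Qed.

Let Jn n : {fset nat} := [fset i in iota 0 n]%fset.

Let mem_Jn n i : (i \in Jn n) = (i < n)%N.
Proof. by rewrite !inE mem_iota. Qed.

Let JnS n : Jn n.+1 = (n |` Jn n)%fset.
Proof.
by apply/fsetP => i; rewrite mem_Jn in_fset1U mem_Jn ltnS leq_eqVlt.
Qed.

(* A pi-system generating the past, on which mutual independence speaks. *)
Let cylinder n : set (set T) := [set A | exists2 A_ : nat -> set T,
  forall i, (i < n)%N -> I i (A_ i) & A = \bigcap_(i in [set` Jn n]) A_ i].

(** For fixed B, the two finite measures P (. `&` B) and P B * P agree on
    cylinders by mutual independence over the indices 0, ..., n, hence on the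
    sigma-field that the cylinders generate. *)
Lemma past_innovation_indep n A B : past n A -> I n B ->
  P (A `&` B) = (P A * P B)%E.
Proof.
move=> pA IB; have mB : measurable B := Im IB.
have IT i : I i setT by have [I0 IC _] := sI i; rewrite -(setD0 setT); exact: IC.
pose r : {nonneg R} := NngNum (fine_ge0 (measure_ge0 P B)).
have rE : (r%:num%:E = P B)%E by rewrite /= fineK// fin_num_measure.
have cylm X : cylinder n X -> measurable X.
  move=> [A_ IA ->]; apply: fin_bigcap_measurable => // i /=.
  by rewrite mem_Jn => ni; apply: Im; exact: IA.
suff : mrestr P mB A = mscale r P A.
  by rewrite /mrestr /mscale/= => ->; rewrite rE muleC.
apply: (@g_sigma_algebra_measure_unique_trace _ R T (cylinder n) setT) => //=.
- by move=> X [/cylm].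
- move=> X Y [[A_ IA ->] _] [[B_ IB' ->] _]; split => //.
  exists (fun i => A_ i `&` B_ i); last by rewrite bigcapI.
  by move=> i ni; apply: sigma_algebra_setI => //; [exact: IA|exact: IB'].
- by rewrite /mrestr /mscale/= setTI (probability_setT P) mule1 rE.
- move=> X [[A_ IA ->] _]; rewrite /mrestr /mscale/= rE.
  (* B is appended to the cylinder as its component of index n *)
  pose B_ i := if (i < n)%N then A_ i else B.
  have B_A i : i \in Jn n -> B_ i = A_ i by rewrite mem_Jn /B_ => ->.
  have BnE : B_ n = B by rewrite /B_ ltnn.
  have -> : \bigcap_(i in [set` Jn n]) A_ i `&` B
      = \bigcap_(i in [set` Jn n.+1]) B_ i.
    rewrite JnS set_fsetU1 bigcap_setU1 BnE setIC; congr (_ `&` _).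
    by apply: eq_bigcapr => i /= /B_A.
  rewrite !indepI.
  + rewrite JnS big_fsetU1/= ?mem_Jn ?ltnn// BnE; congr (_ * _)%E.
    by apply: eq_big_seq => i /B_A ->.
  + by move=> i; rewrite mem_Jn; exact: IA.
  + move=> i; rewrite mem_Jn ltnS leq_eqVlt => /predU1P[->|ni].
      by rewrite BnE.
    by rewrite B_A ?mem_Jn//; exact: IA.
- by rewrite /mrestr setTI ltey_eq fin_num_measure.
- move: A pA; apply: sub_sigma_algebra2 => A [i /= ni IA]; split => //.
  exists (fun j => if j == i then A else setT).
    by move=> j _; case: eqP => [->|].
  apply/seteqP; split => [t At j _|t /(_ i)]; first by case: eqP.
  by rewrite eqxx; apply; rewrite /= mem_Jn.
Qed.

Lemma mean_mul_indic n (Z : T -> R) B : finitely_known (past n) Z -> I n B ->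
  \int[P]_t (Z t * \1_B t) = \int[P]_t Z t * fine (P B).
Proof.
move=> kZ IB; have mB : measurable B := Im IB.
have sm := @measurable_sigma_algebra _ T.
pose s : seq R := fset_set (range Z).
have Zs t : Z t \in s by rewrite in_fset_set ?inE; [exists t|exact: kZ.1].
have mZ z : measurable (Z @^-1` [set z]) by apply: (@past_measurable n); exact: kZ.2.
have Zind t : Z t = \sum_(z <- s) z * \1_(Z @^-1` [set z]) t.
  rewrite (bigD1_seq (Z t)) ?fset_uniq//= indicE mem_set// mulr1 big1 ?addr0// => z zZ.
  rewrite indicE memNset ?mulr0//= => Ztz; by rewrite Ztz eqxx in zZ.
have kind (A : set T) : measurable A -> finitely_known measurable (\1_A : T -> R).
  exact: finitely_known_indic.
have kz (z : R) (A : set T) : measurable A ->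
    finitely_known measurable (fun t => z * \1_A t : R).
  by move=> mA; exact: (finitely_known_comp (fun x => z * x) (kind A mA)).
rewrite (@eq_Rintegral _ _ _ P _
  (fun t => \sum_(z <- s) z * \1_(Z @^-1` [set z] `&` B) t)); last first.
  move=> t _; rewrite {1}Zind mulr_suml; apply: eq_bigr => z _.
  by rewrite indicI/= mulrA.
rewrite mean_sum; last by move=> z _; apply: kz; exact: measurableI.
rewrite (@eq_Rintegral _ _ _ P _
  (fun t => \sum_(z <- s) z * \1_(Z @^-1` [set z]) t)); last by move=> t _; exact: Zind.
rewrite mean_sum; last by move=> z _; exact: kz.
rewrite mulr_suml; apply: eq_bigr => z _.
rewrite !meanZ; [|exact: kind|by apply: kind; exact: measurableI].
rewrite !mean_indic//; last exact: measurableI.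
rewrite (@past_innovation_indep n)//; last exact: kZ.2.
by rewrite fineM ?mulrA// fin_num_measure.
Qed.

End independence_of_the_past.

(** * The memory kernel *)

Lemma sum_seq_delta (R : realType) (E : eqType) (s : seq E) (x : E) (f : E -> R) :
  uniq s -> x \in s -> (forall y, y != x -> f y = 0) -> \sum_(y <- s) f y = f x.
Proof.
by move=> us xs f0; rewrite (bigD1_seq x)//= big1 ?addr0// => y /f0.
Qed.

Lemma sigma_of_sigma_algebra (disp : measure_display) (T : measurableType disp)
    (E : Type) (Y : T -> E) :
  sigma_algebra setT (sigma_of Y).
Proof. by apply: sigma_algebra_preimage; split. Qed.

Lemma finite_rv_known (disp : measure_display) (T : measurableType disp)
    (E : choiceType) (A : {fset E}) (Y : T -> E) (F : set (set T)) :
  finite_rv A Y -> sigma_of Y `<=` F -> finitely_known F Y.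
Proof.
move=> [YA _] YF; split.
  by apply: (@sub_finite_set _ _ [set` A]) => // _ [t _ <-] /=.
by move=> C; apply: YF; exists C => //; rewrite setTI.
Qed.

Section elephant.
Context (R : realType) (d : nat) (Ve Vo : {fset 'rV[R]_d}).
Context (m : nat) (p q : R).
Hypothesis Vopp : Vo = [fset - v | v in Ve]%fset.
Hypothesis Vdisj : (Vo `&` Ve)%fset = fset0.
Hypothesis cardVo : #|` Vo|%fset = m.
Hypothesis m2 : (2 <= m)%N.

Let V : {fset 'rV[R]_d} := (Vo `|` Ve)%fset.

Lemma step_setS k v : v \in step_set Ve Vo k -> v \in (Vo `|` Ve)%fset.
Proof. by rewrite /step_set in_fsetU; case: odd => ->; rewrite ?orbT. Qed.

Lemma step_set_parity k l : odd k = odd l -> step_set Ve Vo k = step_set Ve Vo l.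
Proof. by rewrite /step_set => ->. Qed.

Lemma mem_Vo v : (v \in Vo) = (- v \in Ve).
Proof.
rewrite Vopp; apply/imfsetP/idP => [[w /= wVe ->]|vVe]; first by rewrite opprK.
by exists (- v) => //=; rewrite opprK.
Qed.

Lemma step_set_opp k l v : odd k != odd l -> v \in step_set Ve Vo k ->
  - v \in step_set Ve Vo l /\ v \notin step_set Ve Vo l.
Proof.
have disj w : w \in Vo -> w \in Ve -> False.
  by move=> wo we; have := in_fset0 w; rewrite -Vdisj in_fsetI wo we.
rewrite /step_set; case: (odd k); case: (odd l) => //= _ vW; split.
- by rewrite -mem_Vo.
- by apply/negP; exact: disj.
- by rewrite mem_Vo opprK.
- by apply/negP => /disj; apply.
Qed.

Variable i : 'I_d.

(** The mean of the coordinate i over Vo.  As Ve = - Vo, the mean over the step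
    set of index k.+1 is (-1) ^+ k * center. *)
Definition center : R := (\sum_(v <- Vo) v ord0 i) / m%:R.

Let m0 : (m%:R : R) != 0.
Proof. by rewrite pnatr_eq0; case: m m2. Qed.

Let m1 : (m%:R - 1 : R) != 0.
Proof. by rewrite subr_eq0 -[1]/(1%:R) eqr_nat; case: m m2 => [|[]]. Qed.

Lemma sum_step_set k :
  \sum_(w <- step_set Ve Vo k.+1) w ord0 i = (-1) ^+ k * center * m%:R.
Proof.
rewrite /center mulrA divfK//; rewrite -signr_odd /step_set/=.
case: (odd k) => /=; last by rewrite expr0 mul1r.
rewrite expr1 mulN1r Vopp big_imfset/=; last by move=> v w _ _; exact: oppr_inj.
by rewrite -sumrN; apply: eq_bigr => v _; rewrite mxE opprK.
Qed.

Lemma card_step_set k : size (step_set Ve Vo k) = m.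
Proof.
rewrite /step_set; case: odd; first exact: cardVo.
by move: cardVo; rewrite Vopp card_imfset//; exact: oppr_inj.
Qed.

(** A law on m points that charges x with a and the others equally is a mixture
    of the uniform law and of the point mass at x, the latter with weight
    (m a - 1) / (m - 1); only the point mass moves the mean off the center. *)
Lemma sum_point_mass (a : R) k (x : 'rV[R]_d) : x \in step_set Ve Vo k.+1 ->
  \sum_(w <- step_set Ve Vo k.+1)
    (if w == x then a else (1 - a) / (m%:R - 1)) * (w ord0 i - (-1) ^+ k * center)
  = (m%:R * a - 1) / (m%:R - 1) * (x ord0 i - (-1) ^+ k * center).
Proof.
move=> xW; set c := (-1) ^+ k * center; set b := (1 - a) / (m%:R - 1).
rewrite (eq_bigr (fun w : 'rV[R]_d => b * (w ord0 i) - b * c +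
   (if w == x then a - b else 0) * (w ord0 i - c))); last first.
  by move=> w _; case: eqP => _; ring.
rewrite big_split/= [X in _ + X](sum_seq_delta (fset_uniq _) xW) ?eqxx; last first.
  by move=> w /negbTE ->; rewrite mul0r.
rewrite sumrB -mulr_sumr sum_step_set -/c.
rewrite big_const_seq count_predT card_step_set iter_addr_0 -mulr_natr.
by rewrite /b; field.
Qed.

(** The reason for centering: the kernel of the walk acts on centered
    coordinates as multiplication by alpha or - beta, because a remembered step
    of the opposite parity is reversed before it is copied. *)
Lemma step_law_mean k l (v : 'rV[R]_d) : v \in step_set Ve Vo l.+1 ->
  \sum_(w <- step_set Ve Vo k.+1)
     step_law Ve Vo p q k.+1 v w * (w ord0 i - (-1) ^+ k * center)
  = (if odd k == odd l then erw_alpha m p else - erw_beta m q)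
    * (v ord0 i - (-1) ^+ l * center).
Proof.
move=> vW; rewrite /step_law cardVo; case: eqP => kl.
  have vW' : v \in step_set Ve Vo k.+1.
    by rewrite (@step_set_parity _ l.+1)//= kl.
  by rewrite vW' sum_point_mass// -(signr_odd _ k) kl signr_odd.
have kl' : odd l.+1 != odd k.+1.
  by rewrite /= ; apply/eqP => /negb_inj /esym.
have [vW1 /negbTE ->] := step_set_opp kl' vW.
rewrite sum_point_mass// mxE -(signr_odd _ k) -(signr_odd _ l).
have -> : odd k = ~~ odd l by move: kl; case: odd; case: odd.
by rewrite signrN /erw_beta; ring.
Qed.

Context {disp : measure_display} {T : measurableType disp} (P : probability T R).
Context (U : nat -> T -> nat) (G : nat -> 'rV[R]_d -> T -> 'rV[R]_d)
  (X : nat -> T -> 'rV[R]_d).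
Hypothesis hX : elephant_walk P Ve Vo p q U G X.

Let I := innovation Ve Vo U G X.
Let Fp := past I.

Lemma innovation_sigma_algebra n : sigma_algebra setT (I n).
Proof.
rewrite /I; case: n => [|n]; first exact: sigma_of_sigma_algebra.
exact: smallest_sigma_algebra.
Qed.

Lemma innovation_measurable n : I n `<=` measurable.
Proof.
rewrite /I; case: n => [|n]; first by have [] := erw_X1_rv hX.
apply: smallest_sub; first exact: measurable_sigma_algebra.
move=> A [UA|[v /= vV GA]]; first by have [_] := erw_U_rv hX (ltn0Sn n); apply.
by have [_] := erw_G_rv hX (isT : (2 <= n.+2)%N) vV; apply.
Qed.

Lemma sigma_U_innovation n : (0 < n)%N -> sigma_of (U n) `<=` I n.
Proof. by case: n => // n _ A UA; apply: sub_sigma_algebra; left. Qed.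

Lemma sigma_G_innovation n v : (0 < n)%N -> v \in V ->
  sigma_of (G n.+1 v) `<=` I n.
Proof. by case: n => // n _ vV A GA; apply: sub_sigma_algebra; right; exists v. Qed.

Lemma U_range n t : (0 < n)%N -> (0 < U n t <= n)%N.
Proof.
move=> n0; have [/(_ t)] := erw_U_rv hX n0.
by rewrite !inE mem_iota add1n ltnS.
Qed.

Lemma X_range n t : (0 < n)%N -> X n t \in step_set Ve Vo n.
Proof.
elim/ltn_ind: n => -[//|[|n]] IH _.
  by have [/(_ t)] := erw_X1_rv hX.
rewrite (erw_rec hX)//; have /andP[U0 Un] := U_range t (ltn0Sn n).
have XV := step_setS (IH _ Un U0).
by have [/(_ t)] := erw_G_rv hX (isT : (2 <= n.+2)%N) XV.
Qed.

Lemma past_le a b : (a <= b)%N -> Fp a `<=` Fp b.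
Proof.
by move/subnK <-; elim: (b - a)%N => // k IH; apply: subset_trans IH _; exact: pastS.
Qed.

(** The step X n.+2 is read off from the tuple of earlier steps and the table of
    the values G n.+2 v, by looking up first the remembered step and then its
    image. *)
Lemma X_known n : (0 < n)%N -> finitely_known (Fp n) (X n).
Proof.
elim/ltn_ind: n => -[//|[|n]] IH _.
  apply: finite_rv_known (erw_X1_rv hX) _.
  exact: (@innovation_past _ _ I 0%N).
have sF := past_sigma_algebra I n.+2; rewrite -/Fp in sF.
have IF : I n.+1 `<=` Fp n.+2 := @innovation_past _ _ I n.+1.
have kU : finitely_known (Fp n.+2) (U n.+1).
  apply: finite_rv_known (erw_U_rv hX (ltn0Sn n)) _.
  by apply: subset_trans IF; exact: sigma_U_innovation.
have kX : finitely_known (Fp n.+2) (fun t => [seq X k t | k <- iota 1 n.+1]).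
  apply: finitely_known_map => // k; rewrite mem_iota add1n => /andP[k0 kn].
  by apply: finitely_knownS (IH _ kn k0); apply: past_le; rewrite ltnW.
have kG : finitely_known (Fp n.+2) (fun t => [seq G n.+2 v t | v <- V]).
  apply: finitely_known_map => // v vV.
  apply: finite_rv_known (erw_G_rv hX _ vV) _ => //.
  by apply: subset_trans IF; exact: sigma_G_innovation.
have := finitely_known_comp2 (fun u (xg : seq 'rV[R]_d * seq 'rV[R]_d) =>
  nth 0 xg.2 (index (nth 0 xg.1 u.-1) V)) sF kU (finitely_known_pair sF kX kG).
congr finitely_known; apply/funext => t; rewrite (erw_rec hX)//.
rewrite -[LHS]/(nth 0 [seq G n.+2 v t | v <- V]
  (index (nth 0 [seq X k t | k <- iota 1 n.+1] (U n.+1 t).-1) V)).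
have /andP[U0 Un] := U_range t (ltn0Sn n).
have XV := step_setS (X_range t U0).
rewrite (nth_map 0%N); last by rewrite size_iota prednK.
rewrite nth_iota ?prednK// add1n prednK//.
by rewrite (nth_map 0) ?index_mem// nth_index.
Qed.

Lemma X_known_past k n : (0 < k <= n)%N -> finitely_known (Fp n) (X k).
Proof. by move=> /andP[k0 kn]; exact: finitely_knownS (past_le kn) (X_known k0). Qed.

(** The conditional law of X n.+1 given the first n steps, in integrated form.
    Both sides are split according to the remembered time k, the remembered
    step v and the new step w; the event on U and G is independent of the past,
    and U is independent of G. *)
Lemma elephant_mean n (Y : T -> R) (g : 'rV[R]_d -> R) : (0 < n)%N ->
  finitely_known (Fp n) Y ->
  \int[P]_t (Y t * g (X n.+1 t)) =
  \int[P]_t (Y t * (n%:R^-1 * \sum_(k <- iota 1 n)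
     \sum_(w <- step_set Ve Vo n.+1) step_law Ve Vo p q n.+1 (X k t) w * g w)).
Proof.
move=> n0 kY.
have sF := past_sigma_algebra I n; rewrite -/Fp in sF.
have sI := innovation_sigma_algebra n.
have Fm : Fp n `<=` measurable by apply: past_measurable; exact: innovation_measurable.
have sm := @measurable_sigma_algebra _ T.
pose h k v w t : R := g w * (Y t * \1_(X k @^-1` [set v]) t).
have kh k v w : k \in iota 1 n -> finitely_known (Fp n) (h k v w).
  rewrite mem_iota add1n ltnS => kn.
  apply: (finitely_known_comp (fun x => g w * x)).
  apply: finitely_known_comp2 => //.
  by apply: finitely_known_indic => //; exact: (X_known_past kn).2.
pose B k v w := (U n @^-1` [set k]) `&` (G n.+1 v @^-1` [set w]).
have IB k v w : v \in V -> I n (B k v w).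
  move=> vV; apply: sigma_algebra_setI => //.
    by apply: sigma_U_innovation => //; exists [set k] => //; rewrite setTI.
  by apply: (sigma_G_innovation n0 vV); exists [set w] => //; rewrite setTI.
have kB k v w : v \in V -> finitely_known measurable (\1_(B k v w) : T -> R).
  move=> vV; apply: finitely_known_indic => //.
  by apply: innovation_measurable (IB _ _ _ vV).
have PB k v w : k \in iota 1 n -> v \in V -> w \in step_set Ve Vo n.+1 ->
    fine (P (B k v w)) = n%:R^-1 * step_law Ve Vo p q n.+1 v w.
  rewrite mem_iota add1n ltnS => kn vV wW.
  rewrite /B (erw_UG_indep hX n0); last 2 first.
  - by exists [set k] => //; rewrite setTI.
  - apply: sub_sigma_algebra; exists v => //=.
    by exists [set w] => //; rewrite setTI.
  by rewrite (erw_U_law hX kn) (erw_G_law hX _ vV wW).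
rewrite (@eq_Rintegral _ _ _ P _ (fun t => \sum_(k <- iota 1 n) \sum_(v <- V)
  \sum_(w <- step_set Ve Vo n.+1) h k v w t * \1_(B k v w) t)); last first.
  move=> t _; have Un := U_range t n0; have /andP[U0 _] := Un.
  have XW := X_range t U0; have XV := step_setS XW.
  have [GW _] := erw_G_rv hX (n0 : (2 <= n.+1)%N) XV.
  have Uin : U n t \in iota 1 n by rewrite mem_iota add1n ltnS.
  rewrite (sum_seq_delta (iota_uniq _ _) Uin); last first.
    move=> k kU; rewrite big1// => v _; rewrite big1// => w _.
    rewrite /B indicI/= [\1_(U n @^-1` _) t]indicE memNset ?mul0r ?mulr0//=.
    by move=> Uk; rewrite Uk eqxx in kU.
  rewrite (sum_seq_delta (fset_uniq _) XV); last first.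
    move=> v vX; rewrite big1// => w _.
    rewrite /h [\1_(_ @^-1` _) t]indicE memNset ?mulr0 ?mul0r//=.
    by move=> Xv; rewrite Xv eqxx in vX.
  rewrite (sum_seq_delta (fset_uniq _) (GW t)); last first.
    move=> w wG; rewrite /B indicI/= [\1_(G _ _ @^-1` _) t]indicE memNset ?mulr0//=.
    by move=> Gw; rewrite Gw eqxx in wG.
  rewrite (erw_rec hX)// /h /B indicI/= !indicE !mem_set//.
  by rewrite !mulr1 mulrC.
rewrite [RHS](@eq_Rintegral _ _ _ P _ (fun t => \sum_(k <- iota 1 n) \sum_(v <- V)
  \sum_(w <- step_set Ve Vo n.+1)
     (n%:R^-1 * step_law Ve Vo p q n.+1 v w) * h k v w t)); last first.
  move=> t _; rewrite mulrCA !mulr_sumr; apply: eq_big_seq => k.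
  rewrite mem_iota add1n ltnS => /andP[k0 _].
  have XV := step_setS (X_range t k0).
  rewrite (sum_seq_delta (fset_uniq _) XV); last first.
    move=> v vX; rewrite big1// => w _.
    rewrite /h indicE memNset ?mulr0//= => Xv; by rewrite Xv eqxx in vX.
  rewrite !mulr_sumr; apply: eq_bigr => w _.
  by rewrite /h indicE mem_set// mulr1; ring.
have khm k v w : k \in iota 1 n -> finitely_known measurable (h k v w).
  by move=> kn; exact: finitely_knownS Fm (kh _ _ _ kn).
have kL k v w : k \in iota 1 n -> v \in V ->
    finitely_known measurable (fun t => h k v w t * \1_(B k v w) t).
  by move=> kn vV; apply: finitely_known_comp2 => //; [exact: khm|exact: kB].
have kR k v w : k \in iota 1 n -> finitely_known measurable
    (fun t => (n%:R^-1 * step_law Ve Vo p q n.+1 v w) * h k v w t).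
  by move=> kn; exact: (finitely_known_comp (fun x => _ * x) (khm _ _ _ kn)).
rewrite !mean_sum; last 2 first.
- by move=> k kn; do 2 (apply: finitely_known_sum => // ? ?); exact: kR.
- by move=> k kn; do 2 (apply: finitely_known_sum => // ? ?); exact: kL.
apply: eq_big_seq => k kn.
rewrite !mean_sum; last 2 first.
- by move=> v vV; apply: finitely_known_sum => // ? ?; exact: kR.
- by move=> v vV; apply: finitely_known_sum => // ? ?; exact: kL.
apply: eq_big_seq => v vV.
rewrite !mean_sum; last 2 first.
- by move=> w _; exact: kR.
- by move=> w _; exact: kL.
apply: eq_big_seq => w wW.
rewrite (mean_mul_indic innovation_sigma_algebra innovation_measurable
  (erw_indep hX) (n := n)).
- by rewrite PB// [RHS]meanZ; [rewrite mulrC|exact: khm].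
- exact: kh.
- exact: IB.
Qed.

End elephant.

(** * Removal of the drift *)

Section drift.
Context {R : realType}.
Lemma norm_sign_sum_le (u : nat -> R) (e : nat -> R) C n :
  (forall k, `|u k| <= C) -> (forall k, `|e k| = 1) ->
  `|\sum_(k < n) e k * u k| <= C * n%:R.
Proof.
move=> uC e1; apply: (le_trans (ler_norm_sum _ _ _)).
apply: (@le_trans _ _ (\sum_(k < n) C)).
  by apply: ler_sum => k _; rewrite normrM e1 mul1r.
by rewrite sumr_const card_ord mulr_natr.
Qed.

(** Makes an error of order n^(-3/2) at each step telescope against a potential
    1 / sqrt n. *)
Lemma inv_sqrt_telescope n : (0 < n)%N ->
  (8 * n%:R * Num.sqrt (n.+1%:R : R))^-1 <=
  (Num.sqrt n%:R)^-1 - (Num.sqrt n.+1%:R)^-1 :> R.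
Proof.
move=> n0; set a := Num.sqrt n%:R; set b := Num.sqrt n.+1%:R.
have a1 : 1 <= a by rewrite -[leLHS]sqrtr1 ler_wsqrtr// ler1n.
have b1 : 1 <= b by rewrite -[leLHS]sqrtr1 ler_wsqrtr// ler1n.
have aa : a ^+ 2 = n%:R by rewrite sqr_sqrtr.
have bb : b ^+ 2 = a ^+ 2 + 1 by rewrite aa sqr_sqrtr// natr1.
rewrite -aa.
have b2a : b <= 2 * a by nra.
have ab : a <= b by rewrite /a /b ler_wsqrtr// ler_nat.
rewrite (_ : a^-1 - b^-1 = (a * b * (a + b))^-1); last first.
  have -> : a^-1 - b^-1 = (b - a) / (a * b) by field; rewrite !gt_eqF//; lra.
  have -> : b - a = (a + b)^-1.
    apply: (mulIf (_ : a + b != 0)); first by rewrite gt_eqF//; lra.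
    by rewrite mulVf; [lra|rewrite gt_eqF//; lra].
  by field; rewrite !gt_eqF//; lra.
rewrite lef_pV2 ?posrE.
- by nra.
- by rewrite !mulr_gt0//; nra.
- by rewrite !mulr_gt0//; nra.
Qed.


(** The corrected sum y_n = s_n + (-1)^n (gamma / 2) d_n / n satisfies
    y_(n+1) = (1 + 1 / (2 n)) y_n + xi_n + O(1 / n): the alternating drift
    (-1)^n gamma d_n / n of s_n is cancelled to first order by the change of sign
    of the correction.  Dividing by sqrt n turns the factor 1 + 1 / (2 n) into
    1 + O(1 / n^2); since |y_n| = O(n), this leaves an error O(n^(-3/2)). *)
Lemma drift_step gamma C n (s d e x xi : R) : (0 < n)%N -> 0 <= C ->
  `|e| = 1 -> `|s| <= C * n%:R -> `|d| <= C * n%:R -> `|x| <= C ->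
  x = n%:R^-1 * (2^-1 * s + e * gamma * d) + xi ->
  `| (s + x - e * (gamma / 2) * (d + e * x) / n.+1%:R) / Num.sqrt n.+1%:R
     - (s + e * (gamma / 2) * d / n%:R) / Num.sqrt n%:R
     - xi / Num.sqrt n.+1%:R |
  <= 3 * C * (1 + `|gamma|) / (n%:R * Num.sqrt n.+1%:R).
Proof.
move=> n0 C0 e1 sC dC xC xE.
have n1 : 1 <= n%:R :> R by rewrite ler1n.
have nS : n.+1%:R = n%:R + 1 :> R by rewrite natr1.
have bb : Num.sqrt n.+1%:R ^+ 2 = n%:R + 1 :> R by rewrite sqr_sqrtr.
have aa : Num.sqrt n%:R ^+ 2 = n%:R :> R by rewrite sqr_sqrtr.
have a1 : 1 <= Num.sqrt n%:R :> R by rewrite -[leLHS]sqrtr1 ler_wsqrtr.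
have b1 : 1 <= Num.sqrt n.+1%:R :> R by rewrite -[leLHS]sqrtr1 ler_wsqrtr// ler1n.
rewrite nS; move: bb aa a1 b1.
set N : R := n%:R in n1 sC dC xE *; rewrite nS -/N.
set a := Num.sqrt N; set b := Num.sqrt _ => bb aa a1 b1.
have N0 : 0 < N := lt_le_trans ltr01 n1.
have Np0 : 0 < N + 1 by rewrite addr_gt0.
have a0 : 0 < a := lt_le_trans ltr01 a1.
have b0 : 0 < b := lt_le_trans ltr01 b1.
have ee : e ^+ 2 = 1 by rewrite -(real_normK (num_real e)) e1 expr1n.
set g := `|gamma|; have g0 : 0 <= g by exact: normr_ge0.
pose y := s + e * (gamma / 2) * d / N.
pose rho := e * (gamma / 2) * (d / N) / (N + 1) - gamma / 2 * x / (N + 1)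
            - e * (gamma / 4) * (d / N) / N.
have nN : `|N| = N by rewrite ger0_norm//; lra.
have nN1 : `|N + 1| = N + 1 by rewrite ger0_norm//; lra.
have dN : `|d / N| <= C.
  by rewrite normrM normfV nN ler_pdivrMr//; lra.
have rhoE : s + x - e * (gamma / 2) * (d + e * x) / (N + 1)
    = (1 + (2 * N)^-1) * y + rho + xi.
  rewrite (_ : e * (gamma / 2) * (d + e * x) / (N + 1)
    = e * (gamma / 2) * d / (N + 1) + e ^+ 2 * (gamma / 2) * x / (N + 1)); last by ring.
  rewrite ee /rho /y {1}xE; field; rewrite !gt_eqF//.
have rho_le : `|rho| <= 2 * g * C / N.
  have bnd z c : `|z| <= C -> `|c| <= g / 2 -> `|c * z / N| <= g / 2 * C / N.
    move=> zC cg; rewrite !normrM normfV nN.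
    by rewrite ler_wpM2r ?invr_ge0 ?ler_pM//; lra.
  have eg c : 0 <= c <= 2^-1 -> `|e * (gamma * c)| <= g / 2.
    by move=> c2; rewrite !normrM e1 mul1r -/g (ger0_norm (_ : 0 <= c)); nra.
  have shrink z : `|z / (N + 1)| <= `|z / N|.
    rewrite !normrM !normfV nN nN1.
    by rewrite ler_wpM2l// lef_pV2 ?posrE ?lerDl// addr_gt0.
  rewrite /rho; apply: (le_trans (ler_normB _ _)).
  apply: (@le_trans _ _ (g / 2 * C / N + g / 2 * C / N + g / 2 * C / N)).
    apply: lerD; last by apply: bnd => //; apply: eg; lra.
    apply: (le_trans (ler_normB _ _)); apply: lerD.
      by apply: (le_trans (shrink _)); apply: bnd => //; apply: eg; lra.
    apply: (le_trans (shrink _)); apply: bnd => //.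
    by rewrite normrM -/g ger0_norm; lra.
  have : 0 <= g * C * N^-1 by rewrite !mulr_ge0// invr_ge0 ltW.
  by rewrite -!mulrA; lra.
have y_le : `|y| <= C * N * (1 + g).
  rewrite /y; apply: (le_trans (ler_normD _ _)).
  have : `|e * (gamma / 2) * d / N| <= C * g.
    rewrite -mulrA !normrM e1 mul1r -/g -normrM (ger0_norm (_ : 0 <= 2^-1))//; nra.
  have : 0 <= C * g by rewrite mulr_ge0.
  nra.
rewrite rhoE -/y.
(* k is the error made in treating sqrt as an exact solution of the recursion:
   ((1 + 1 / (2 N)) a)^2 exceeds b^2 only by 1 / (4 N). *)
pose k := (1 + (2 * N)^-1) / b - a^-1.
rewrite (_ : _ - _ - _ = k * y + rho / b); last first.
  by rewrite /k; field; rewrite !gt_eqF//.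
have k_le : `|k| <= (8 * N * N * b)^-1.
  pose h := (1 + (2 * N)^-1) * a.
  have i0 : 0 < (2 * N)^-1 by rewrite invr_gt0 mulr_gt0.
  have ha : a <= h by rewrite /h; nra.
  have hb : (h - b) * (h + b) = (4 * N)^-1.
    rewrite -subr_sqr bb /h exprMn aa; field; exact: lt0r_neq0 N0.
  have ab : a <= b.
    by rewrite -(@ler_pXn2r _ 2%N) ?nnegrE ?sqrtr_ge0// bb aa lerDl.
  have hbE : h - b = (4 * N * (h + b))^-1.
    by rewrite [RHS]invfM -hb mulfK// gt_eqF// addr_gt0// (lt_le_trans a0).
  have kE : k = (4 * N * (h + b) * a * b)^-1.
    have -> : k = (h - b) / (a * b).
      by rewrite /k /h; field; rewrite !gt_eqF//.
    by rewrite hbE -invfM; congr (_^-1); ring.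
  have hb0 : 0 < h + b by rewrite addr_gt0// (lt_le_trans a0).
  rewrite kE ger0_norm; last by rewrite invr_ge0 ltW// !mulr_gt0.
  rewrite lef_pV2 ?posrE ?mulr_gt0//.
  have -> : 8 * N * N * b = 4 * N * (2 * a ^+ 2) * b by rewrite aa; ring.
  have -> : 4 * N * (h + b) * a * b = 4 * N * ((h + b) * a) * b by ring.
  rewrite ler_wpM2r ?(ltW b0)// ler_wpM2l ?mulr_ge0 ?(ltW N0)// expr2 mulrA.
  by rewrite ler_wpM2r ?(ltW a0)//; lra.
apply: (le_trans (ler_normD _ _)).
have Nb0 : 0 < (N * b)^-1 by rewrite invr_gt0 mulr_gt0.
have t1 : `|k * y| <= C * (1 + g) / 8 * (N * b)^-1.
  rewrite normrM.
  apply: (@le_trans _ _ ((8 * N * N * b)^-1 * (C * N * (1 + g)))).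
    by rewrite ler_pM.
  by rewrite le_eqVlt; apply/orP; left; apply/eqP; field; rewrite !gt_eqF//.
have t2 : `|rho / b| <= 2 * g * C * (N * b)^-1.
  rewrite normrM normfV (ger0_norm (ltW b0)).
  apply: (@le_trans _ _ (2 * g * C / N / b)).
    by rewrite ler_wpM2r// invr_ge0 ltW.
  by rewrite invfM mulrA.
have Cg : 0 <= C * g by rewrite mulr_ge0.
apply: (le_trans (lerD t1 t2)); rewrite -mulrDl ler_wpM2r ?(ltW Nb0)//; lra.
Qed.

(** Up to a constant K that depends only on gamma and on the bound C on the steps,
    the sums s_n are governed by the noise alone: the errors of the steps are
    controlled by the trivial bounds |s_n| <= C n and |d_n| <= C n. *)
Lemma drift_removal gamma C : 0 <= C ->
  exists K : R, forall u xi : nat -> R, (forall k, `|u k| <= C) ->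
  (forall n, (0 < n)%N -> u n =
     n%:R^-1 * (2^-1 * (\sum_(k < n) u k)
                + (-1) ^+ n * gamma * (\sum_(k < n) (-1) ^+ k * u k)) + xi n) ->
  forall n, (0 < n)%N ->
    `|\sum_(k < n) u k| / Num.sqrt n%:R <=
      K + `|\sum_(1 <= k < n) xi k / Num.sqrt k.+1%:R|.
Proof.
move=> C0; pose g := `|gamma|; pose K1 := 3 * C * (1 + g).
have g0 : 0 <= g by exact: normr_ge0.
have Cg : 0 <= C * g by rewrite mulr_ge0.
exists (8 * K1 + C * (1 + g) + C * g) => u xi uC uE.
pose s n := \sum_(k < n) u k; pose d n := \sum_(k < n) (-1) ^+ k * u k.
pose y n := s n + (-1) ^+ n * (gamma / 2) * d n / n%:R.
pose M n := \sum_(1 <= k < n) xi k / Num.sqrt k.+1%:R.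
have sign1 n : `|(-1) ^+ n| = 1 :> R by rewrite normrX normrN1 expr1n.
have dC n : `|d n| <= C * n%:R by apply: norm_sign_sum_le.
have sC n : `|s n| <= C * n%:R.
  rewrite /s; under eq_bigr do rewrite -[u _]mul1r.
  by apply: (@norm_sign_sum_le u (fun=> 1)) => // k; rewrite normr1.
have corr n : (0 < n)%N -> `|(-1) ^+ n * (gamma / 2) * d n / n%:R| <= C * g.
  move=> n0; have n0' : 0 < n%:R :> R by rewrite ltr0n.
  rewrite normrM normfV normr_nat ler_pdivrMr// !normrM sign1 mul1r -/g.
  rewrite (ger0_norm (_ : 0 <= 2^-1))//; have := dC n; nra.
(* the potential - 8 K1 / sqrt n absorbs the error of each step *)
have inv n : (0 < n)%N ->
    `|y n / Num.sqrt n%:R - M n| <= 8 * K1 + C * (1 + g) - 8 * K1 / Num.sqrt n%:R.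
  elim: n => // n IH _; have [->|n0] := posnP n.
    rewrite sqrtr1 !divr1 /M big_geq// subr0 addrAC subrr add0r.
    by rewrite /y (le_trans (ler_normD _ _))//; have := corr 1%N isT; have := sC 1%N; lra.
  have uE' := uE n n0; rewrite -/(s n) -/(d n) in uE'.
  have step := drift_step n0 C0 (sign1 n) (sC n) (dC n) (uC n) uE'.
  have tele := inv_sqrt_telescope n0.
  have yS : y n.+1 = s n + u n
      - (-1) ^+ n * (gamma / 2) * (d n + (-1) ^+ n * u n) / n.+1%:R.
    by rewrite /y /s /d !big_ord_recr/= exprS; ring.
  have MS : M n.+1 = M n + xi n / Num.sqrt n.+1%:R by rewrite /M big_nat_recr.
  rewrite -yS -/(y n) -/g -/K1 in step.
  have K1_0 : 0 <= K1 by rewrite /K1; lra.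
  have {}tele : K1 / (n%:R * Num.sqrt n.+1%:R) <=
      8 * K1 * ((Num.sqrt n%:R)^-1 - (Num.sqrt n.+1%:R)^-1).
    apply: (@le_trans _ _ (8 * K1 * (8 * n%:R * Num.sqrt n.+1%:R)^-1)).
      by rewrite -(mulrA 8 n%:R) [(8 * _)^-1]invfM mulrACA divff ?mul1r// pnatr_eq0.
    by rewrite ler_wpM2l//; lra.
  rewrite MS (_ : _ - _ = (y n.+1 / Num.sqrt n.+1%:R - y n / Num.sqrt n%:R
    - xi n / Num.sqrt n.+1%:R) + (y n / Num.sqrt n%:R - M n)); last by ring.
  by apply: (le_trans (ler_normD _ _)); have := IH n0; lra.
move=> n n0; have sn1 : 1 <= Num.sqrt n%:R :> R.
  by rewrite -[leLHS]sqrtr1 ler_wsqrtr// ler1n.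
have -> : `|\sum_(k < n) u k| / Num.sqrt n%:R = `|s n / Num.sqrt n%:R|.
  by rewrite normrM normfV (ger0_norm (_ : 0 <= Num.sqrt _)).
rewrite (_ : s n / _ = (y n / Num.sqrt n%:R - M n) + M n
   - (-1) ^+ n * (gamma / 2) * d n / n%:R / Num.sqrt n%:R); last by rewrite /y; ring.
have c' : `|(-1) ^+ n * (gamma / 2) * d n / n%:R / Num.sqrt n%:R| <= C * g.
  rewrite (normrM _ (Num.sqrt _)^-1) normfV.
  rewrite (ger0_norm (_ : 0 <= Num.sqrt _))// ler_pdivrMr; last lra.
  by have := corr n n0; nra.
apply: (le_trans (ler_normB _ _)).
have := ler_normD (y n / Num.sqrt n%:R - M n) (M n).
have := inv n n0; have K1_0 : 0 <= 8 * K1 / Num.sqrt n%:R.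
  by rewrite mulr_ge0 ?invr_ge0//; rewrite /K1; lra.
rewrite -/(M n); lra.
Qed.
End drift.

(** * Doubly exponential blocks *)

Section levels.
Context {R : realType}.

(** Writing x `^ (- h) as (x + 1) `^ (- h) times expR (h (ln (x + 1) - ln x)),
    both the exponential and the logarithm are bounded by their tangents. *)
Lemma powR_telescope (h x : R) : 0 < h -> 0 < x ->
  h * ((x + 1) `^ (1 + h))^-1 <= x `^ (- h) - (x + 1) `^ (- h).
Proof.
move=> h0 x0; have y0 : 0 < x + 1 by rewrite addr_gt0.
have lnxy : (x + 1)^-1 <= ln (x + 1) - ln x.
  have := @le_ln1Dx R (- (x + 1)^-1).
  have -> : 1 - (x + 1)^-1 = x / (x + 1) by field; rewrite gt_eqF.
  rewrite lnM ?posrE ?invr_gt0// lnV ?posrE//.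
  have i1 : (x + 1)^-1 < 1 by rewrite invf_lt1//; lra.
  by rewrite ltrN2 => /(_ i1); lra.
have -> : x `^ (- h) = (x + 1) `^ (- h) * expR (h * (ln (x + 1) - ln x)).
  by rewrite /powR !gt_eqF// -expRD; congr expR; ring.
rewrite powRD; last by rewrite (gt_eqF y0) implybT.
rewrite powRr1 ?(ltW y0)// powRN invfM.
have w0 : 0 < ((x + 1) `^ h)^-1 by rewrite invr_gt0 powR_gt0.
set w := (_ `^ h)^-1 in w0 *; rewrite (mulrC (x + 1)^-1) mulrCA.
rewrite -[X in _ - X]mulr1 -mulrBr ler_wpM2l ?(ltW w0)//.
have := expR_ge1Dx (h * (ln (x + 1) - ln x)).
have : h * (x + 1)^-1 <= h * (ln (x + 1) - ln x) by rewrite ler_wpM2l// ltW.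
lra.
Qed.

Lemma powR_series_le (h : R) n : 0 < h ->
  \sum_(0 <= j < n) ((j.+2)%:R `^ (1 + h))^-1 <= h^-1 :> R.
Proof.
move=> h0; rewrite -(ler_pM2l h0) mulfV ?gt_eqF// mulr_sumr.
apply: (@le_trans _ _ (1 - n.+1%:R `^ (- h))).
  elim: n => [|n IH]; first by rewrite big_geq// powR1 subrr.
  rewrite big_nat_recr//=; apply: (le_trans (lerD IH (lexx _))).
  have := @powR_telescope h n.+1%:R h0 (ltr0Sn _ _); rewrite natr1; lra.
by rewrite gerBl powR_ge0.
Qed.

Lemma harmonic_sum_pow2_le M :
  \sum_(0 <= i < 2 ^ M) (i.+1%:R)^-1 <= M%:R + 1 :> R.
Proof.
elim: M => [|M IH]; first by rewrite expn0 big_nat1 invr1 add0r.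
rewrite (@big_cat_nat _ _ _ (2 ^ M)%N)//=; last by rewrite leq_pexp2l.
have : \sum_(2 ^ M <= i < 2 ^ M.+1) (i.+1%:R)^-1 <= 1 :> R.
  apply: (@le_trans _ _ (\sum_(2 ^ M <= i < 2 ^ M.+1) ((2 ^ M)%:R)^-1)).
    rewrite big_seq [leRHS]big_seq; apply: ler_sum => i.
    rewrite mem_index_iota => /andP[Mi _].
    rewrite lef_pV2 ?posrE ?ltr0n ?expn_gt0// ler_nat; exact: leqW.
  rewrite big_const_nat iter_addr_0 expnS mul2n -addnn addnK.
  by rewrite -(mulr_natr (_ ^-1)) mulVf//.
rewrite -natr1; lra.
Qed.
End levels.

Section dyadic_blocks.
Context {disp : measure_display} {T : measurableType disp} {R : realType}
  (P : probability T R).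

(** Up to time 2 ^ (2 ^ j.+1) the assumed maximal inequality has a numerator of
    order 2 ^ j, as the harmonic sum grows like the logarithm.  At the
    squared level 2 ^ j * (j.+2) `^ (1 + h) the probability of an excess is then
    O((j.+2) `^ (- (1 + h))), which is summable, and the Borel-Cantelli lemma
    applies. *)
Lemma dyadic_control (N : nat -> T -> R) (c h : R) : 0 <= c -> 0 < h ->
  (forall (l : R) k, measurable [set t | l <= `|N k t|]) ->
  (forall (l : R) n, 0 < l ->
    (P (\bigcup_(k in [set k | (k <= n)%N]) [set t | (l <= `|N k t|)%R])
     <= (c * (\sum_(0 <= i < n) (i.+1%:R)^-1) / l ^+ 2)%:E)%E) ->
  {ae P, forall t, exists J, forall j k, (J <= j)%N -> (k <= 2 ^ (2 ^ j.+1))%N ->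
     N k t ^+ 2 < 2 ^+ j * (j.+2)%:R `^ (1 + h)}.
Proof.
move=> c0 h0 mN bN.
pose v j : R := 2 ^+ j * (j.+2)%:R `^ (1 + h).
have w0 j : 0 < (j.+2)%:R `^ (1 + h) :> R by rewrite powR_gt0.
have v0 j : 0 < v j by rewrite mulr_gt0 ?exprn_gt0.
pose E j := \bigcup_(k in [set k | (k <= 2 ^ (2 ^ j.+1))%N])
   [set t | Num.sqrt (v j) <= `|N k t|].
have mE j : measurable (E j) by exact: bigcup_measurable.
have PE j : (P (E j) <= (3 * c * ((j.+2)%:R `^ (1 + h))^-1)%:E)%E.
  apply: (le_trans (bN _ _ _)); first by rewrite sqrtr_gt0.
  rewrite sqr_sqrtr ?(ltW (v0 _))// lee_fin /v invfM mulrA.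
  rewrite ler_wpM2r ?invr_ge0 ?(ltW (w0 j))//.
  rewrite ler_pdivrMr ?exprn_gt0// -mulrA mulrCA ler_wpM2l//.
  apply: (le_trans (harmonic_sum_pow2_le _)).
  rewrite natrX exprS; have : 1 <= 2 ^+ j :> R by rewrite exprn_ege1// ler1n.
  lra.
exists (lim_sup_set E); split.
- apply: bigcap_measurable => // n _; exact: bigcup_measurable.
- apply: lim_sup_set_cvg0 => //.
  apply: (@le_lt_trans _ _ (3 * c * h^-1)%:E); last exact: ltry.
  apply: lime_le; first exact: is_cvg_nneseries.
  apply: nearW => n.
  apply: (@le_trans _ _ (\sum_(0 <= j < n) (3 * c * ((j.+2)%:R `^ (1 + h))^-1)%:E)%E).
    by apply: lee_sum => j _; exact: PE.
  rewrite sumEFin lee_fin -mulr_sumr ler_wpM2l ?mulr_ge0//.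
  exact: powR_series_le.
- move=> t /= nJ n _; apply: contrapT => nE; apply: nJ; exists n => j k nj kj.
  rewrite -(real_normK (num_real (N k t))) -[ltRHS](sqr_sqrtr (ltW (v0 j))).
  rewrite ltr_pXn2r ?nnegrE ?sqrtr_ge0// ltNge; apply/negP => vN.
  by apply: nE; exists j => //; exists k.
Qed.

End dyadic_blocks.

Section asymptotics.
Context {R : realType}.

Lemma cvgr_ln : @ln R x @[x --> +oo] --> +oo.
Proof.
apply/cvgryPge => A; near=> x.
have Ax : expR A <= x by near: x; exact: nbhs_pinfty_ge.
by rewrite -[A]expRK ler_ln ?posrE ?expR_gt0// (lt_le_trans (expR_gt0 A)).
Unshelve. all: by end_near. Qed.

Lemma cvgn_ln : @ln R n%:R @[n --> \oo] --> +oo.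
Proof. exact: cvg_comp _ _ cvgr_idn cvgr_ln. Qed.

Lemma cvgn_lnln : @ln R (ln n%:R) @[n --> \oo] --> +oo.
Proof. exact: cvg_comp _ _ cvgn_ln cvgr_ln. Qed.

Lemma lnln_powRN_cvg0 (h : R) : 0 < h -> (ln (ln n%:R)) `^ (- h) @[n --> \oo] --> (0 : R).
Proof.
move=> h0.
have hln : h * ln y @[y --> (+oo : set_system R)] --> (+oo : set_system R).
  exact: (gt0_cvgMry h0 cvgr_ln).
have elim := cvg_comp _ _ cvgn_lnln (cvg_comp _ _ hln (@cvgr_expR R)).
apply: cvg_trans elim; apply: near_eq_cvg; near=> n.
have L0 : 0 < ln (ln n%:R) :> R by near: n; exact: (cvgryPgt _).1 cvgn_lnln 0.
by rewrite /= /powR gt_eqF// mulNr.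
Unshelve. all: by end_near. Qed.

Lemma ln2_ge_half : 2^-1 <= ln 2 :> R.
Proof.
have := @le_ln1Dx R (- 2^-1).
have -> : 1 - 2^-1 = 2^-1 :> R by field.
by rewrite lnV ?posrE// ltrN2 => /(_ _); rewrite lerN2; apply; rewrite invf_lt1// ltr1n.
Qed.

Lemma block_of n J : (2 ^ (2 ^ J) <= n)%N ->
  exists j, [/\ (J <= j)%N, (n <= 2 ^ (2 ^ j.+1))%N & (2 ^ (2 ^ j) <= n)%N].
Proof.
move=> Jn; have n0 : (0 < n)%N by apply: leq_trans Jn; rewrite expn_gt0.
pose M := trunc_log 2 n; have JM : (2 ^ J <= M)%N by exact: trunc_log_max.
have M0 : (0 < M)%N by apply: leq_trans JM; rewrite expn_gt0.
have /andP[Mn nM] := trunc_log_bounds (isT : (1 < 2)%N) n0; rewrite -/M in Mn nM.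
have /andP[jM Mj] := trunc_log_bounds (isT : (1 < 2)%N) M0.
exists (trunc_log 2 M); split.
- exact: trunc_log_max.
- apply: (leq_trans (ltnW nM)); by rewrite leq_exp2l.
- by apply: leq_trans Mn; rewrite leq_exp2l.
Qed.

(** In the block of index j, ln n is of order 2 ^ j and ln (ln n) of order j.
    The factor 6 comes from j.+2 <= 2 ln (ln n) + 4, with 1 <= ln (ln n). *)
Lemma block_level_le (h : R) j n : 0 < h -> (2 ^ (2 ^ j) <= n)%N ->
  1 <= ln (ln n%:R) :> R ->
  2 ^+ j * (j.+2)%:R `^ (1 + h) <=
    2 * 6 `^ (1 + h) * (ln n%:R * (ln (ln n%:R)) `^ (1 + h)) :> R.
Proof.
move=> h0 jn L1; have l2 := ln2_ge_half.
have lnn : 2 ^+ j * 2^-1 <= ln n%:R :> R.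
  apply: (@le_trans _ _ (ln (2 ^+ (2 ^ j)))).
    by rewrite lnXn// -(mulr_natl (ln 2)) natrX ler_wpM2l.
  rewrite ler_ln ?posrE ?exprn_gt0//; first by rewrite -natrX ler_nat.
  by rewrite ltr0n; apply: leq_trans jn; rewrite expn_gt0.
have p0 : 0 < 2 ^+ j * 2^-1 :> R by rewrite mulr_gt0 ?exprn_gt0 ?invr_gt0.
have lnn0 := lt_le_trans p0 lnn.
have jL : (j.+2)%:R <= 6 * ln (ln n%:R) :> R.
  have : ln (2 ^+ j * 2^-1) <= ln (ln n%:R) :> R by rewrite ler_ln ?posrE.
  rewrite lnM ?posrE ?exprn_gt0 ?invr_gt0// lnV ?posrE// lnXn// -(mulr_natl (ln 2)).
  have : 2^-1 * (j%:R) <= j%:R * ln 2 :> R by rewrite mulrC ler_wpM2l.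
  have l2' : ln 2 <= 1 :> R.
    by have := @le_ln1Dx R 1; rewrite (_ : 1 + 1 = 2)//; apply; lra.
  rewrite -[j.+2%:R]natr1 -[j.+1%:R]natr1; lra.
rewrite mulrACA ler_pM ?exprn_ge0 ?powR_ge0//.
  by move: lnn; lra.
rewrite -powRM//; last by rewrite (le_trans _ L1).
apply: ge0_ler_powR => //; rewrite ?nnegrE//; lra.
Qed.

End asymptotics.

(** * Growth of a coordinate *)

Section coordinate.
Context (R : realType) (d : nat) (Ve Vo : {fset 'rV[R]_d}) (m : nat) (p q : R).
Hypothesis Vopp : Vo = [fset - v | v in Ve]%fset.
Hypothesis Vdisj : (Vo `&` Ve)%fset = fset0.
Hypothesis cardVo : #|` Vo|%fset = m.
Hypothesis m2 : (2 <= m)%N.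
Hypothesis critical : erw_delta m p q = 2^-1.
Context {disp : measure_display} {T : measurableType disp} (P : probability T R).
Context (U : nat -> T -> nat) (G : nat -> 'rV[R]_d -> T -> 'rV[R]_d)
  (X : nat -> T -> 'rV[R]_d).
Hypothesis hX : elephant_walk P Ve Vo p q U G X.
Variable i : 'I_d.

Let c : R := center Vo m i.
Let gamma : R := (erw_alpha m p + erw_beta m q) / 2.
Let I := innovation Ve Vo U G X.

(** By symmetry X k.+1 is uniform on its step set, so (-1) ^+ k * c is the mean of
    its coordinate. *)
Definition centered k (t : T) : R := X k.+1 t ord0 i - (-1) ^+ k * c.

(** The conditional mean of centered n given the first n steps, written with
    alpha = 1/2 + gamma and - beta = 1/2 - gamma, which is how the hypothesis
    delta = 1/2 enters: the plain sum always comes with the coefficient 1/2 and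
    the parity only affects the alternating sum. *)
Definition predicted n (t : T) : R :=
  n%:R^-1 * (2^-1 * (\sum_(k < n) centered k t)
             + (-1) ^+ n * gamma * (\sum_(k < n) (-1) ^+ k * centered k t)).

(** The value 0 at index 0 makes X 1 the initial value of the recursion rather
    than a martingale increment. *)
Definition noise n (t : T) : R :=
  if n is 0 then 0 else centered n t - predicted n t.

Let sF n := past_sigma_algebra I n.
Let Fm n : past I n `<=` measurable.
Proof. by apply: past_measurable => k; exact: innovation_measurable hX k. Qed.

Lemma centered_known k n : (k < n)%N -> finitely_known (past I n) (centered k).
Proof.
move=> kn; apply: (finitely_known_comp (fun v : 'rV[R]_d => v ord0 i - (-1) ^+ k * c)).
exact: (X_known_past hX).
Qed.

Lemma predicted_known n : finitely_known (past I n) (predicted n).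
Proof.
apply: (finitely_known_comp (fun x => n%:R^-1 * x)).
apply: finitely_known_comp2 => //.
- apply: (finitely_known_comp (fun x => 2^-1 * x)).
  by apply: finitely_known_sum => // k _; exact: centered_known.
- apply: (finitely_known_comp (fun x => (-1) ^+ n * gamma * x)).
  apply: finitely_known_sum => // k _.
  by apply: (finitely_known_comp (fun x => (-1) ^+ k * x)); exact: centered_known.
Qed.

Lemma noise_known n : finitely_known (past I n.+1) (noise n).
Proof.
case: n => [|n]; first exact: finitely_known_cst.
apply: (finitely_known_comp2 (fun x y => x - y)) => //; first exact: centered_known.
exact: finitely_knownS (@pastS _ _ I n.+1) (predicted_known n.+1).
Qed.

Lemma conditional_mean n (t : T) : (0 < n)%N ->
  n%:R^-1 * \sum_(k <- iota 1 n) \sum_(w <- step_set Ve Vo n.+1)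
    step_law Ve Vo p q n.+1 (X k t) w * (w ord0 i - (-1) ^+ n * c)
  = predicted n t.
Proof.
move=> n0; rewrite /predicted; congr (_ * _).
have -> : iota 1 n = index_iota 1 n.+1 by rewrite /index_iota subSS subn0.
rewrite big_add1/= big_mkord !mulr_sumr -big_split/=; apply: eq_bigr => k _.
have XW := X_range hX t (ltn0Sn k).
rewrite (step_law_mean p q Vopp Vdisj cardVo m2 i n XW) -/c -/(centered k t).
have ab : erw_alpha m p = erw_beta m q + 1.
  by move: critical; rewrite /erw_delta; lra.
rewrite -(signr_odd _ n) -(signr_odd _ k) /gamma ab.
by case: (odd n); case: (odd k); rewrite /= ?expr0 ?expr1; field.
Qed.

Lemma noise_orthogonal n (Y : T -> R) : finitely_known (past I n) Y ->
  \int[P]_t (Y t * noise n t) = 0.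
Proof.
case: n => [|n] kY.
  by under eq_Rintegral do rewrite mulr0; rewrite mean_cst.
rewrite /noise; under eq_Rintegral do rewrite mulrBr.
have kYm := finitely_knownS (@Fm _) kY.
have sm := @measurable_sigma_algebra _ T.
have kc := finitely_knownS (@Fm _) (centered_known (ltnSn n.+1)).
have kp := finitely_knownS (@Fm _) (predicted_known n.+1).
rewrite RintegralB//; last 2 first.
- exact: (finitely_known_integrable P (finitely_known_comp2 *%R sm kYm kc)).
- exact: (finitely_known_integrable P (finitely_known_comp2 *%R sm kYm kp)).
rewrite (elephant_mean hX (fun w => w ord0 i - (-1) ^+ n.+1 * c) (ltn0Sn n) kY).
by under eq_Rintegral do rewrite conditional_mean//; rewrite subrr.
Qed.

Let C : R := \sum_(v <- (Vo `|` Ve)%fset) `|v ord0 i| + `|c|.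

Let C0 : 0 <= C.
Proof. by rewrite addr_ge0// sumr_ge0. Qed.

Lemma centered_le k t : `|centered k t| <= C.
Proof.
apply: (le_trans (ler_normB _ _)); rewrite normrM normrX normrN1 expr1n mul1r lerD2r.
have XV := step_setS (X_range hX t (ltn0Sn k)).
by rewrite (big_rem _ XV)/= lerDl sumr_ge0.
Qed.

Lemma noise_le n t : `|noise n t| <= C * (2 + `|gamma|).
Proof.
have g0 := normr_ge0 gamma; have Cg := mulr_ge0 C0 g0.
case: n => [|n]; first by rewrite normr0 mulr_ge0// addr_ge0.
apply: (le_trans (ler_normB _ _)).
have bnd (g a b e M : R) : `|e| = 1 -> `|a| <= M -> `|b| <= M ->
    `|2^-1 * a + e * g * b| <= M * (1 + `|g|).
  move=> e1 aM bM; apply: (le_trans (ler_normD _ _)).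
  rewrite !normrM e1 mul1r (ger0_norm (_ : 0 <= 2^-1))//.
  by have := normr_ge0 a; have := ler_wpM2l (normr_ge0 g) bM; lra.
have : `|predicted n.+1 t| <= C * (1 + `|gamma|).
  rewrite normrM normfV normr_nat mulrC ler_pdivrMr ?ltr0n// [leRHS]mulrAC.
  apply: bnd; first by rewrite normrX normrN1 expr1n.
    under eq_bigr do rewrite -[centered _ _]mul1r.
    apply: (@norm_sign_sum_le _ (fun k => centered k t) (fun=> 1)) => k.
      exact: centered_le.
    exact: normr1.
  apply: (@norm_sign_sum_le _ (fun k => centered k t) (fun k => (-1) ^+ k)) => k.
    exact: centered_le.
  by rewrite normrX normrN1 expr1n.
have := centered_le n.+1 t; lra.
Qed.

Let D n (t : T) : R := noise n t / Num.sqrt n.+1%:R.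
Let N n (t : T) : R := \sum_(k < n) D k t.

(** The centers cancel in pairs, so centering moves the position by at most one
    center. *)
Lemma position_coord n t :
  `|position X n t ord0 i| <= `|\sum_(k < n) centered k t| + `|c|.
Proof.
have -> : position X n t ord0 i = \sum_(k < n) centered k t + (odd n)%:R * c.
  elim: n => [|n IH]; first by rewrite big_ord0 mxE mul0r addr0.
  rewrite big_ord_recr/= mxE IH /centered -(signr_odd _ n).
  by case: (odd n) => /=; rewrite ?expr0 ?expr1; ring.
apply: (le_trans (ler_normD _ _)); rewrite lerD2l normrM normr_nat.
by case: odd; rewrite ?mul1r// mul0r.
Qed.

(** The weights 1 / sqrt n.+1 give the increments D a second moment O(1 / n), so
    their sums have a variance of order at most ln n. *)
Lemma noise_sum_control (h : R) : 0 < h ->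
  {ae P, forall t, exists J, forall j k, (J <= j)%N -> (k <= 2 ^ (2 ^ j.+1))%N ->
     N k t ^+ 2 < 2 ^+ j * (j.+2)%:R `^ (1 + h)}.
Proof.
move=> h0; have kD n : finitely_known (past I n.+1) (D n).
  exact: (finitely_known_comp (fun x => x / Num.sqrt n.+1%:R) (noise_known n)).
have sm := @measurable_sigma_algebra _ T.
have kN n : finitely_known measurable (N n).
  by apply: finitely_known_sum => // k _; exact: finitely_knownS (@Fm _) (kD k).
apply: (@dyadic_control _ _ _ P N ((C * (2 + `|gamma|)) ^+ 2)) => //.
- exact: sqr_ge0.
- by move=> l k; exact: ((kN k).2 [set x | l <= `|x|]).
move=> l n l0; rewrite mulr_sumr big_mkord.
apply: (@kolmogorov_inequality _ _ _ P (past I) D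
  (fun k => (C * (2 + `|gamma|)) ^+ 2 * (k.+1%:R)^-1)) => //.
- by move=> k; exact: pastS.
- move=> k t; rewrite /D exprMn exprVn sqr_sqrtr//.
  rewrite ler_wpM2r ?invr_ge0// -(real_normK (num_real (noise k t))).
  by rewrite lerXn2r ?nnegrE// ?noise_le// mulr_ge0// addr_ge0.
- move=> k Y kY; under eq_Rintegral do rewrite /D mulrA.
  under eq_Rintegral do rewrite mulrC.
  rewrite meanZ ?noise_orthogonal ?mulr0//.
  have kYm := finitely_knownS (@Fm _) kY.
  have kn := finitely_knownS (@Fm _) (noise_known k).
  exact: (finitely_known_comp2 *%R).
Qed.

(** Half of the excess exponent is spent on making the probabilities of the
    blocks summable: h will be eta / 2, and the other half sends the quotient
    to 0. *)
Lemma coordinate_growth (h : R) : 0 < h ->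
  {ae P, forall t, exists K, \forall n \near \oo,
     position X n t ord0 i ^+ 2 <=
       K * (n%:R * (ln n%:R * (ln (ln n%:R)) `^ (1 + h)))}.
Proof.
move=> h0; have [K HK] := drift_removal gamma C0.
apply: filterS (noise_sum_control h0) => t [J HJ].
pose K' := K + `|c|; pose b := 2 * 6 `^ (1 + h) : R.
exists (2 * K' ^+ 2 + 2 * b); near=> n.
have n0 : (0 < n)%N by near: n; exact: nbhs_infty_gt.
have Jn : (2 ^ (2 ^ J) <= n)%N by near: n; exact: nbhs_infty_ge.
have l1 : 1 <= ln n%:R :> R by near: n; exact: (cvgryPge _).1 cvgn_ln 1.
have L1 : 1 <= ln (ln n%:R) :> R by near: n; exact: (cvgryPge _).1 cvgn_lnln 1.
have [j [Jj nj jn]] := block_of Jn.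
have Nn := HJ j n Jj nj; have lev := block_level_le h0 jn L1.
have drift := HK (fun k => centered k t) (fun k => noise k t) (fun k => centered_le k t).
have NE : \sum_(1 <= k < n) noise k t / Num.sqrt k.+1%:R = N n t.
  rewrite /N -(big_mkord predT (fun k => D k t)) (big_ltn n0).
  by rewrite [D 0%N t]mul0r add0r.
have {drift} : `|\sum_(k < n) centered k t| / Num.sqrt n%:R <= K + `|N n t|.
  rewrite -NE; apply: drift => // -[//|k] _.
  by rewrite /noise/= addrC subrK.
have s1 : 1 <= Num.sqrt n%:R :> R by rewrite -[leLHS]sqrtr1 ler_wsqrtr// ler1n.
have s0 := lt_le_trans ltr01 s1; rewrite ler_pdivrMr// => drift.
have pos : `|position X n t ord0 i| <= (K' + `|N n t|) * Num.sqrt n%:R.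
  apply: (le_trans (position_coord n t)); rewrite /K'.
  have := normr_ge0 c; nra.
set Q := ln n%:R * _; have Q1 : 1 <= Q.
  apply: (le_trans l1); rewrite ler_peMr ?(le_trans ler01)//.
  apply: (@le_trans _ _ (1 `^ (1 + h))); first by rewrite powR1.
  by apply: ge0_ler_powR; rewrite ?nnegrE//; lra.
have nn : Num.sqrt n%:R ^+ 2 = n%:R :> R by rewrite sqr_sqrtr.
rewrite -(real_normK (num_real (position X n t ord0 i))).
have := real_normK (num_real (N n t)); have := normr_ge0 (N n t).
have := normr_ge0 (position X n t ord0 i).
move: `|N n t| `|position _ _ _ _ _| pos => x y pos y0 x0 xN.
apply: (@le_trans _ _ (((K' + x) * Num.sqrt n%:R) ^+ 2)).
  by rewrite lerXn2r ?nnegrE// (le_trans y0).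
rewrite exprMn nn mulrC [leRHS]mulrCA ler_wpM2l//.
have square_split (a z e r : R) : z ^+ 2 <= e * r -> a ^+ 2 <= a ^+ 2 * r ->
    (a + z) ^+ 2 <= (2 * a ^+ 2 + 2 * e) * r.
  by move=> ze ar; have := sqr_ge0 (a - z); rewrite sqrrB sqrrD; lra.
apply: square_split; first by rewrite xN (le_trans (ltW Nn)).
by rewrite ler_peMr ?sqr_ge0.
Unshelve. all: by end_near. Qed.

End coordinate.

(** * The position *)

Theorem theorem2p16 (R : realType) (d : nat) (hd : (1 <= d)%N)
    (Se So : set 'rV[R]_d) (Ve Vo : {fset 'rV[R]_d})
    (hlattice : erw_lattice Se So Ve Vo)
    (m : nat) (hVo : #|` Vo|%fset = m) (hVe : #|` Ve|%fset = m)
    (hm : (2 <= m)%N)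
    (p q : R) (hp : 0 <= p <= 1) (hq : 0 <= q <= 1)
    (disp : measure_display) (T : measurableType disp) (P : probability T R)
    (U : nat -> T -> nat) (G : nat -> 'rV[R]_d -> T -> 'rV[R]_d)
    (X : nat -> T -> 'rV[R]_d)
    (hX : elephant_walk P Ve Vo p q U G X)
    (hdelta : erw_delta m p q = 2^-1)
    (eta : R) (heta : 0 < eta) :
  {ae P, forall t,
    seq_littleo (fun n => enorm (position X n t))
      (fun n => Num.sqrt
        (n%:R * ln (n%:R) * (ln (ln (n%:R))) `^ (1 + eta)))}.
Proof.
have h0 : 0 < eta / 2 by rewrite divr_gt0.
pose good (k : nat) t := forall i : 'I_d, i = k :> nat ->
  exists K, \forall n \near \oo, position X n t ord0 i ^+ 2 <=
    K * (n%:R * (ln n%:R * (ln (ln n%:R)) `^ (1 + eta / 2))).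
have : forall k, {ae P, forall t, good k t}.
  move=> k; have [kd|dk] := ltnP k d; last first.
    by apply: aeW => t i ik; have := ltn_ord i; rewrite ik ltnNge dk.
  apply: filterS (coordinate_growth (lattice_opp hlattice)
    (lattice_disjoint hlattice) hVo hm hdelta hX (Ordinal kd) h0) => t Ht i ik.
  by have <- : Ordinal kd = i by exact: val_inj.
move=> /ae_foralln; apply: filterS => t all_good.
have {all_good} : forall i : 'I_d, exists K, \forall n \near \oo,
    position X n t ord0 i ^+ 2 <=
    K * (n%:R * (ln n%:R * (ln (ln n%:R)) `^ (1 + eta / 2))).
  by move=> i; exact: (all_good i).
move=> /choice[K HK].
rewrite /seq_littleo.
(* the squared quotient is at most K1 * (ln (ln n)) `^ (- (eta / 2)) *)
pose K1 := \sum_i K i.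
have bound0 : Num.sqrt (K1 * (ln (ln n%:R)) `^ (- (eta / 2))) @[n --> \oo] --> (0 : R).
  have lim0 : K1 * (ln (ln n%:R)) `^ (- (eta / 2)) @[n --> \oo] --> (0 : R).
    by rewrite -(mulr0 K1); apply: cvgM; [exact: cvg_cst|exact: lnln_powRN_cvg0].
  by rewrite -[X in _ --> X]sqrtr0; apply: (cvg_comp _ _ lim0); exact: sqrt_continuous.
apply: (squeeze_cvgr _ (cvg_cst 0) bound0).
near=> n; rewrite divr_ge0 ?sqrtr_ge0//=.
have n0 : (0 < n)%N by near: n; exact: nbhs_infty_gt.
have l1 : 1 <= ln n%:R :> R by near: n; exact: (cvgryPge _).1 cvgn_ln 1.
have L1 : 1 <= ln (ln n%:R) :> R by near: n; exact: (cvgryPge _).1 cvgn_lnln 1.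
have coord : forall i, position X n t ord0 i ^+ 2 <=
    K i * (n%:R * (ln n%:R * (ln (ln n%:R)) `^ (1 + eta / 2))).
  by near: n; apply: filter_forall => i; exact: HK.
have n0' : 0 < n%:R :> R by rewrite ltr0n.
have l0 := lt_le_trans ltr01 l1; have L0 := lt_le_trans ltr01 L1.
rewrite /enorm -sqrtrV -?sqrtrM; last 2 first.
- by rewrite sumr_ge0// => i _; exact: sqr_ge0.
- by rewrite !mulr_ge0 ?powR_ge0// ltW.
rewrite ler_wsqrtr// ler_pdivrMr ?mulr_gt0 ?powR_gt0//.
apply: (@le_trans _ _ (\sum_i K i *
    (n%:R * (ln n%:R * (ln (ln n%:R)) `^ (1 + eta / 2))))).
  by apply: ler_sum => i _; exact: coord.
rewrite -mulr_suml -/K1 -!mulrA.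
rewrite (_ : 1 + eta = eta / 2 + (1 + eta / 2)); last by field.
rewrite [in leRHS]powRD; last by rewrite (gt_eqF L0) implybT.
rewrite powRN le_eqVlt; apply/orP; left; apply/eqP.
by field; rewrite gt_eqF ?powR_gt0//.
Unshelve. all: by end_near. Qed.
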